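(* Let $X,Y$ be Banach spaces and let $u:\mathbb{R}_{\ge 0}\to\mathcal{L}(X;Y)$ be a function. Then the following are equivalent: (a) for each $x\in X$ there is $t_x\ge 0$ such that the orbit $u_x$ is continuous on $(t_x,\infty)$; (b) there is $t\ge 0$ such that for all $x\in X$ the orbit $u_x$ is continuous on $(t,\infty)$.
   Context: $X,Y$ are Banach spaces over the same field $\mathbb{R}$ or $\mathbb{C}$; $\mathcal{L}(X;Y)$ is the space of bounded linear operators from $X$ to $Y$; $\mathbb{R}_{\ge 0}=[0,\infty)$. No continuity or other regularity of $u$ is assumed. For $x\in X$, the orbit is the function $u_x:\mathbb{R}_{\ge 0}\to Y$, $u_x(t)=u(t)x$. *)

(* Defs.v *)
From HB Require Import structures.
From mathcomp Require Import all_boot all_order all_algebra.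
From mathcomp Require Import complex.
From mathcomp Require Import all_classical all_reals all_analysis.

Set Implicit Arguments.
Unset Strict Implicit.
Unset Printing Implicit Defensive.

Import Order.TTheory GRing.Theory Num.Theory.
Import numFieldNormedType.Exports.

Local Open Scope classical_set_scope.
Local Open Scope ring_scope.
Local Open Scope complex_scope.

Inductive real_or_complex (R : realType) : numFieldType -> Prop :=
| RealScalars : real_or_complex R R
| ComplexScalars : real_or_complex R R[i].

(* For K = R[i] the order of K is partial and `|x| takes values in K: the
   inequality below forces M to be real unless X is trivial. *)
Record bounded_operator (K : numFieldType) (X Y : normedModType K) :=
  BoundedOperator {
    operator_linear :> {linear X -> Y};
    operator_bounded :
      exists M : K, forall x : X, `|operator_linear x| <= M * `|x|
  }.

(* A set coerces to its subtype, which carries the subspace topology. *)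
Definition nonneg_reals (R : realType) : set R := [set t | 0 <= t].
Arguments nonneg_reals : clear implicits.

Definition op_orbit (R : realType) (K : numFieldType) (X Y : normedModType K)
    (u : nonneg_reals R -> bounded_operator X Y) (x : X) : nonneg_reals R -> Y :=
  fun t => u t x.

Definition open_ray (R : realType) (t : nonneg_reals R) :
    set (nonneg_reals R) :=
  [set s | set_val t < set_val s].

(* Main.v *)
Require Import Defs.
From mathcomp Require Import all_boot all_order all_algebra.
From mathcomp Require Import all_classical all_reals all_analysis.
From mathcomp Require Import complex.

Set Implicit Arguments.
Unset Strict Implicit.
Unset Printing Implicit Defensive.

Import Order.TTheory GRing.Theory Num.Theory.
Import numFieldNormedType.Exports.

Local Open Scope classical_set_scope.
Local Open Scope ring_scope.

(** Let C_s be the set of vectors whose orbit is continuous at s: it is a linear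
subspace of X. The proof rests on the dichotomy that, for each s, either
C_s = X or C_s is meagre.

To see this, let E_(s,N) be the closed set of all x with
|u(s)x - u(t)x| <= 1 for every t within 1/(N+1) of s. Continuity with tolerance
1 puts C_s inside the union of the sets E_(s,N) over N, and so inside the union
of the closed sets F_(s,N), the intersection of E_(s,N) with the closure of
C_s. Suppose that some F_(s,N) contains a ball. By linearity the operators
u(s) - u(t), for t close to s, are then uniformly bounded on a ball around 0;
equicontinuity makes C_s closed (continuity_vectors_closure). So C_s contains a
ball, and a linear subspace containing a ball is the whole space
(continuity_vectors_full). Otherwise all the F_(s,N) have empty interior and
C_s is meagre.

If no common ray exists, there is for each n a point s_n > n at which some
orbit is discontinuous, that is, C_(s_n) is not X. But each x lies in C_(s_n)
as soon as n >= t_x, so X is the union of countably many meagre sets, which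
Baire's theorem forbids (common_continuity_point).

Baire's theorem is proved for complete normed modules over any number field in
which the inverses of positive integers are eventually smaller than every
positive element (baire_closed_cover). This covers real and complex scalars
alike, although the order of the complex numbers is partial: all radii in the
construction are of the form 1/(k+1), hence comparable. *)

(** * Scalars with arbitrarily small integer inverses *)

Definition arbitrarily_small_invS (K : numFieldType) : Prop :=
  forall x : K, 0 < x -> exists n : nat, n.+1%:R^-1 < x.

(** The complex case reduces to the real one because a positive complex number
is real. *)
Lemma real_or_complex_small_invS (R : realType) (K : numFieldType) :
  real_or_complex R K -> arbitrarily_small_invS K.
Proof.
have realP (x : R) : 0 < x -> exists n : nat, n.+1%:R^-1 < x.
  move=> x0; exists (Num.truncn x^-1).
  by rewrite -ltf_pV2 ?posrE// invrK truncnS_gt.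
case=> // -[a b]; rewrite ltcE /= => /andP[/eqP -> /realP[n na]].
exists n; have -> : n.+1%:R^-1 = (n.+1%:R^-1%:C)%C :> R[i]%C.
  by rewrite fmorphV /= rmorph_nat.
by rewrite ltcR.
Qed.

(** * Baire's theorem for coverings by closed sets *)

(** Over a partially ordered field, a norm is comparable with M only when M is
real. *)
Lemma closed_norm_ball (K : numFieldType) (V : normedModType K) (x : V)
    (M : K) :
  M \is Num.real -> closed [set z | `|x - z| <= M].
Proof.
move=> Mr y cly /=; rewrite real_leNgt//; apply/negP => My.
have [|z [/= zM]] := cly (ball y (`|x - y| - M)).
  by apply: nbhsx_ballx; rewrite subr_gt0.
rewrite -ball_normE /= => yz.
suff : `|x - y| < `|x - y| by rewrite ltxx.
rewrite (le_lt_trans (ler_distD z _ _))// (le_lt_trans (lerD zM (lexx _)))//.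
by rewrite -ltrBrDl distrC.
Qed.

Section baire.
Variables (K : numFieldType) (X : completeNormedModType K).
Hypothesis small_invK : arbitrarily_small_invS K.

(** One step of the nested-ball construction. A ball is recorded by its centre
and an index k standing for the radius 1/(k+1): such radii are totally ordered,
and the bound on k makes them tend to 0 along the construction. *)
Lemma shrink_ball_avoid (F : set X) (x : X) (r : K) (m : nat) :
  closed F -> interior F = set0 -> 0 < r ->
  exists p : X * nat, (m <= p.2)%N /\
    [set z | `|p.1 - z| <= p.2.+1%:R^-1] `<=` ball x r `&` ~` F.
Proof.
move=> cF F0 r0.
have [y [xy nFy]] : exists y, ball x r y /\ ~ F y.
  apply: contrapT => H.
  have : interior F x.
    apply/nbhs_ballP; exists r => // z xz.
    by apply: contrapT => nFz; apply: H; exists z.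
  by rewrite F0.
have : nbhs y (ball x r `&` ~` F).
  apply: filterI; first by apply: open_nbhs_nbhs; split=> //; exact: ball_open.
  by apply: open_nbhs_nbhs; split => //; exact: closed_openC.
move=> /nbhs_ballP[d /= d0 dH]; have [n nd] := small_invK d0.
exists (y, maxn m n) => /=; split; first exact: leq_maxl.
move=> z /= yz; apply: dH; rewrite -ball_normE /=.
apply: le_lt_trans yz _; apply: le_lt_trans nd.
by rewrite lef_pV2 ?posrE// ler_nat ltnS leq_maxr.
Qed.

Theorem baire_closed_cover (I : countType) (F : I -> set X) :
  (forall i, closed (F i)) -> (forall x, exists i, F i x) ->
  exists i, interior (F i) !=set0.
Proof.
move=> cF covF; apply: contrapT => noint.
have F0 i : interior (F i) = set0.
  by rewrite -subset0 => x Fx; apply: noint; exists i, x.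
(* The cover is reindexed by nat, with empty sets at the codes of no index. *)
pose G n := if unpickle n is Some i then F i else set0.
have cG n : closed (G n) by rewrite /G; case: unpickle => // ; exact: closed0.
have G0 n : interior (G n) = set0.
  by rewrite /G; case: unpickle => //; rewrite interior0.
have /choice[f Pf] : forall q : nat * (X * nat), exists p : X * nat,
    (q.1 <= p.2)%N /\ [set z | `|p.1 - z| <= p.2.+1%:R^-1] `<=`
      ball q.2.1 (q.2.2.+1%:R^-1) `&` ~` G q.1.
  by move=> [n [x k]]; apply: shrink_ball_avoid.
pose fix a n := if n is p.+1 then f (p, a p) else (0 : X, 0%N).
pose B n := [set z | `|(a n).1 - z| <= (a n).2.+1%:R^-1].
have BS n : B n.+1 `<=` B n `&` ~` G n.
  move=> z /(proj2 (Pf (n, a n)))[/= + nG]; rewrite -ball_normE /= => /ltW.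
  by split.
have Bmono n m : (n <= m)%N -> B m `<=` B n.
  elim: m => [|m IH]; first by rewrite leqn0 => /eqP ->.
  by rewrite leq_eqVlt => /orP[/eqP -> //|/IH H] z /BS[/H].
have Ba n : B n (a n).1 by rewrite /B /= subrr normr0.
have : cvg ((fun n => (a n).1) @ \oo).
  apply/cauchy_cvgP/cauchy_exP => e /small_invK[n ne].
  exists (a n.+1).1, n.+1 => // m /= nm.
  rewrite -ball_normE /=; apply: le_lt_trans (Bmono _ _ nm _ (Ba m)) _.
  apply: le_lt_trans ne.
  rewrite lef_pV2 ?posrE// ler_nat ltnS; exact: (proj1 (Pf (n, a n))).
move=> /cvg_ex[/= l al].
have Bl n : B n l.
  apply: (@closed_cvg _ _ \oo _ (fun n => (a n).1) (B n)) al.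
    by apply: closed_norm_ball; rewrite ger0_real.
  by exists n => // m /= nm; apply: Bmono nm _ (Ba m).
have [i Fi] := covF l.
by have [_] := BS _ _ (Bl (pickle i).+1); rewrite /G pickleK.
Qed.
End baire.

(** * Vectors whose orbit is continuous at a given point *)

Section orbits.
Variables (R : realType) (T : pseudoMetricType R) (K : numFieldType).
Variables (X Y : normedModType K) (u : T -> {linear X -> Y}).

Definition continuity_vectors (s : T) : set X :=
  [set x | {for s, continuous (fun t => u t x)}].

Definition oscillation_le1 (s : T) (N : nat) : set X :=
  [set x | forall t, ball s N.+1%:R^-1 t -> `|u s x - u t x| <= 1].

Lemma continuity_vectorsZD (s : T) (a : K) (x y : X) :
  continuity_vectors s x -> continuity_vectors s y ->
  continuity_vectors s (a *: x + y).
Proof.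
rewrite /continuity_vectors /= => cx cy.
have -> : (fun t => u t (a *: x + y)) = (fun t => a *: u t x + u t y).
  by apply/funext => t; rewrite linearP.
apply: continuousD => //; apply: continuousZ => //; exact: cst_continuous.
Qed.

Lemma continuity_vectors_oscillation (s : T) (x : X) :
  continuity_vectors s x -> exists N, oscillation_le1 s N x.
Proof.
move=> /cvgrPdist_le /(_ 1 ltr01) /nbhs_ballP[d /= d0 dH].
have [N Nd] := real_or_complex_small_invS (RealScalars R) d0.
by exists N => t st; apply: dH; apply: le_ball st; exact: ltW.
Qed.

Lemma closed_oscillation_le1 (s : T) (N : nat) :
  (forall t, continuous (u t)) -> closed (oscillation_le1 s N).
Proof.
move=> cu x clx t st.
have cst : continuous (fun z => u s z - u t z).
  by move=> z; apply: cvgB; exact: cu.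
have cB := @closed_norm_ball K Y 0 1 (ger0_real ler01).
have : [set z | `|0 - (u s z - u t z)| <= 1] x; last by rewrite /= sub0r normrN.
have cpre : closed ((fun z => u s z - u t z) @^-1` [set y | `|0 - y| <= 1]).
  by apply: preimage_closed cB => z _; exact: cst.
apply: cpre.
apply: closure_subset clx => z zH /=; rewrite sub0r normrN; exact: zH.
Qed.

(** If all x in a ball satisfy the oscillation bound, translating the ball to 0
shows that u(s) - u(t) is bounded by 2 on a fixed ball around 0, uniformly for t
near s. Equicontinuity then passes continuity at s to limits of vectors. *)
Lemma continuity_vectors_closure (s : T) (N : nat) (y : X) (d : K) :
  0 < d -> ball y d `<=` oscillation_le1 s N ->
  closure (continuity_vectors s) `<=` continuity_vectors s.
Proof.
move=> d0 yd.
have small z t : `|z| < d -> ball s N.+1%:R^-1 t -> `|u s z - u t z| <= 2.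
  move=> zd st.
  have : ball y d (y + z) by rewrite -ball_normE /= opprD addNKr normrN.
  move=> /yd/(_ t st) yz.
  have /yd/(_ t st) yy : ball y d y by exact: ballxx.
  have -> : u s z - u t z = (u s (y + z) - u t (y + z)) - (u s y - u t y).
    rewrite (linearD (u s)) (linearD (u t)) (opprD (u t y)).
    by rewrite addrACA [RHS]addrC addKr.
  by rewrite (le_trans (ler_normB _ _))// -[2]/(1 + 1) lerD.
move=> x clx; apply/cvgrPdist_le => e e0.
(* The scale c turns the bound 2 on the ball of radius d into the bound e / 2 on
   the ball of radius c * d. *)
pose c := e / 2 / 2.
have c0 : 0 < c by rewrite !divr_gt0.
have [x' [Cx']] := clx _ (nbhsx_ballx x (c * d) (mulr_gt0 c0 d0)).
rewrite -ball_normE /= => xx'.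
have e20 : 0 < e / 2 by rewrite divr_gt0.
have : \forall t \near s, `|u s x' - u t x'| <= e / 2.
  by move/cvgrPdist_le : Cx' => /(_ _ e20).
have : \forall t \near s, ball s N.+1%:R^-1 t.
  by apply: nbhsx_ballx; rewrite invr_gt0.
apply: filterS2 => t st x't.
have : `|u s (c^-1 *: (x - x')) - u t (c^-1 *: (x - x'))| <= 2.
  by apply: small st; rewrite normrZ ger0_norm ?invr_ge0 ?ltW// ltr_pdivrMl.
rewrite (linearZZ (u s)) (linearZZ (u t)) -scalerBr normrZ.
rewrite ger0_norm ?invr_ge0 ?(ltW c0)// ler_pdivrMl//.
rewrite /c divfK ?pnatr_eq0// => xx't.
have -> : u s x - u t x = (u s (x - x') - u t (x - x')) + (u s x' - u t x').
  rewrite (linearB (u s)) (linearB (u t)) (opprB (u t x)).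
  by rewrite addrACA subrK [X in _ = _ + X]addrAC subrr add0r.
by rewrite (splitr e) (le_trans (ler_normD _ _))// lerD.
Qed.

(** By the previous lemma the subspace of continuity vectors contains a ball, so
after scaling it absorbs every vector. *)
Lemma continuity_vectors_full (s : T) (N : nat) :
  interior (oscillation_le1 s N `&` closure (continuity_vectors s)) !=set0 ->
  forall x, continuity_vectors s x.
Proof.
move=> [y /nbhs_ballP[d /= d0 yd]] x.
have Cball : ball y d `<=` continuity_vectors s.
  move=> z yz; apply: (@continuity_vectors_closure s N y d) => //.
    by move=> z' /yd[].
  by have [] := yd _ yz.
pose c := d / (`|x| + 1).
have x1 : 0 < `|x| + 1 by rewrite ltr_wpDl.
have c0 : 0 < c by rewrite divr_gt0.
have Cy := Cball _ (ballxx y d0).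
have Cyx : continuity_vectors s (y + c *: x).
  apply: Cball; rewrite -ball_normE /= opprD addNKr normrN normrZ.
  by rewrite gtr0_norm// /c mulrAC ltr_pdivrMr// ltr_pM2l// ltrDl.
have -> : x = c^-1 *: ((-1) *: y + (y + c *: x)) + 0.
  by rewrite scaleN1r addKr scalerA mulVf ?gt_eqF// scale1r addr0.
apply: continuity_vectorsZD; first exact: continuity_vectorsZD.
have -> : 0 = (-1) *: y + y by rewrite scaleN1r addNr.
exact: continuity_vectorsZD.
Qed.
End orbits.

(** The use of Baire's theorem: if every orbit is continuous at some point of a
sequence, the sets F of index (n, N) cover X, and one with nonempty interior
gives an n at which all orbits are continuous. *)
Theorem common_continuity_point (R : realType) (T : pseudoMetricType R)
    (K : numFieldType) (X : completeNormedModType K) (Y : normedModType K)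
    (u : T -> {linear X -> Y}) (s : nat -> T) :
  arbitrarily_small_invS K ->
  (forall t, continuous (u t)) ->
  (forall x, exists n, {for s n, continuous (fun t => u t x)}) ->
  exists n, forall x, {for s n, continuous (fun t => u t x)}.
Proof.
move=> small_invK cu covs.
pose F (q : nat * nat) :=
  oscillation_le1 u (s q.1) q.2 `&` closure (continuity_vectors u (s q.1)).
have [||[n N] FnN] := @baire_closed_cover K X small_invK _ F.
- move=> q; apply: closedI; first exact: closed_oscillation_le1.
  exact: closed_closure.
- move=> x; have [n Cx] := covs x.
  have [N Nx] := continuity_vectors_oscillation Cx.
  by exists (n, N); split => //; exact: subset_closure.
by exists n; exact: continuity_vectors_full FnN.
Qed.

(** * Bounded operators and open rays *)

(** The bound is replaced by its absolute value since a bound for an operator on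
the trivial space may be any scalar. *)
Lemma bounded_operator_continuous (K : numFieldType) (X Y : normedModType K)
  (f : bounded_operator X Y) : continuous f.
Proof.
have [M HM] := operator_bounded f.
apply: bounded_linear_continuous.
apply/ex_bound; exists `|M|.
near=> x.
have x1 : `|x| <= 1.
  near: x; apply/nbhs_ballP; exists 1 => //= x.
  rewrite -ball_normE /= sub0r normrN.
  exact: ltW.
apply: le_trans (HM x) _.
have : 0 <= M * `|x| by exact: le_trans (HM x).
move=> /ger0_norm <-; rewrite normrM normr_id.
by rewrite ler_piMr.
Unshelve. all: by end_near. Qed.

Lemma open_open_ray (R : realType) (t : nonneg_reals R) : open (open_ray t).
Proof.
have -> : open_ray t = set_val @^-1` [set r : R | set_val t < r] by [].
apply: open_comp; last exact: open_gt.
by move=> x _; exact: initial_continuous.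
Qed.

(** An open ray is open in the half-line, so continuity of the restriction to it
is continuity of the function at each of its points. *)
Lemma continuous_on_open_ray (R : realType) (Y : topologicalType)
    (t : nonneg_reals R) (f : nonneg_reals R -> Y) :
  {within open_ray t, continuous f} <->
  forall s, open_ray t s -> {for s, continuous f}.
Proof.
rewrite continuous_open_subspace; last exact: open_open_ray.
by split=> [H s ts | H s /set_mem]; [apply: H; rewrite inE|apply: H].
Qed.

(** * Orbits that are eventually continuous *)

Theorem proposition3p6 (R : realType) (K : numFieldType)
    (hK : real_or_complex R K) (X Y : completeNormedModType K)
    (u : nonneg_reals R -> bounded_operator X Y) :
  (forall x : X, exists t_x : nonneg_reals R,
     {within open_ray t_x, continuous (op_orbit u x)})
  <->
  (exists t : nonneg_reals R, forall x : X,
     {within open_ray t, continuous (op_orbit u x)}).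
Proof.
split=> [evc|[t ct] x]; last by exists t.
apply: contrapT => nct.
pose tn (n : nat) : nonneg_reals R := exist _ n%:R (mem_set (ler0n R n)).
have /choice[s Ps] : forall n, exists s, open_ray (tn n) s /\
    ~ forall x, {for s, continuous (op_orbit u x)}.
  move=> n; apply: contrapT => H; apply: nct; exists (tn n) => x.
  apply/continuous_on_open_ray => s ns.
  apply: contrapT => nc; apply: H; exists s; split => // cs; exact: nc.
have [n cn] : exists n, forall x, {for s n, continuous (op_orbit u x)}.
  apply: (@common_continuity_point R (nonneg_reals R) K X Y
           (fun t => operator_linear (u t))).
  - exact: real_or_complex_small_invS hK.
  - by move=> t; exact: bounded_operator_continuous.
  - move=> x; have [t /continuous_on_open_ray ct] := evc x.
    exists (Num.truncn (set_val t)).+1; apply: ct.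
    have [+ _] := Ps (Num.truncn (set_val t)).+1.
    by apply: lt_trans; exact: truncnS_gt.
by have [_] := Ps n; apply.
Qed.
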